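(* Let $k$ be a given positive integer. Then, as $n\to\infty$, $$\mathbb{E}[X_{n,n+1}^k]=\left(\frac{1}{10}\right)^k n^{2k}+O(n^{2k-1}).$$
   Context: A partition $\lambda=(\lambda_1\ge\dots\ge\lambda_\ell)$ has size $|\lambda|=\sum_i\lambda_i$. The hook length of a box of its Young diagram is the number of boxes directly to its right, directly below it, plus the box itself. For a positive integer $t$, $\lambda$ is a $t$-core if none of its hook lengths is divisible by $t$; an $(s,t)$-core is both an $s$-core and a $t$-core. $X_{n,n+1}$ denotes the size of a partition chosen uniformly at random from the finite set of $(n,n+1)$-core partitions with distinct parts. *)

(* Defs.v *)
From HB Require Import structures.
From mathcomp Require Import all_boot all_order all_algebra finmap.
From mathcomp Require Import boolp classical_sets functions cardinality reals.
From mathcomp Require Import topology normedtype landau.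
Set Implicit Arguments.
Unset Strict Implicit.
Unset Printing Implicit Defensive.
Import Order.TTheory GRing.Theory Num.Theory.
Import numFieldNormedType.Exports.
Local Open Scope nat_scope.

Definition is_partition (s : seq nat) : bool :=
  sorted geq s && all (leq 1) s.

Record partition := Partition {
  parts :> seq nat;
  partitionP : is_partition parts
}.

HB.instance Definition _ := [isSub for parts].
HB.instance Definition _ := [Countable of partition by <:].

Definition psize (la : partition) : nat := sumn la.

(* Rows and columns are numbered from 0: the boxes of the diagram are the
   pairs (i, j) with i < size la and j < nth 0 la i.  The column of (i, j) has
   a box in row i' exactly when the part in row i' exceeds j. *)
Definition arm (la : partition) (i j : nat) : nat := nth 0 la i - j.+1.

Definition leg (la : partition) (i j : nat) : nat :=
  count (fun p => j < p) (drop i.+1 la).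

Definition hook_length (la : partition) (i j : nat) : nat :=
  (arm la i j + leg la i j).+1.

Definition is_core (t : nat) (la : partition) : Prop :=
  forall i j, i < size la -> j < nth 0 la i -> ~~ (t %| hook_length la i j).

Definition distinct_cores_set (s t : nat) : set partition :=
  [set la | [/\ is_core s la, is_core t la & uniq la]]%classic.

(* [fset_set A] is the finite set with the elements of [A] when [A] is finite;
   finiteness in the case t = s + 1 is [finite_distinct_cores_set] below. *)
Definition distinct_cores (s t : nat) : {fset partition} :=
  fset_set (distinct_cores_set s t).

Definition uniform_expectation (R : realType) (T : choiceType)
    (A : {fset T}) (X : T -> R) : R :=
  ((\sum_(x <- A) X x) / #|` A|%:R)%R.

(* Along the first row, hook lengths decrease to 1 by steps of at most 2. *)
Lemma distinct_core_head_le n (la : partition) :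
  distinct_cores_set n n.+1 la -> head 0 la <= n.
Proof.
case: la => [[|a s] laP] [] //=; set la := Partition _ => cn cn1 /andP[ans us].
rewrite leqNgt; apply/negP => lna.
have := laP; rewrite /is_partition /= => /andP[pth /andP[a0 _]].
have s_lt b : b \in s -> b < a.
  move=> bs; rewrite ltn_neqAle; apply/andP; split.
    by apply: contraNneq ans => <-.
  have geq_trans : transitive geq by move=> x y z /= xy yz; exact: leq_trans yz xy.
  by have /allP/(_ _ bs) := order_path_min geq_trans pth.
pose f j := (a - j.+1 + count (fun p => j < p) s).+1.
have f_hook j : j < a -> f j != n /\ f j != n.+1.
  move=> ja; have := cn 0 j isT ja; have := cn1 0 j isT ja.
  rewrite /hook_length /arm /leg /= drop0 -/(f j) => h1 h2.
  by split; apply: contraTneq isT => e; move: h1 h2; rewrite e dvdnn ?andbF.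
have ex : exists j, (j < a) && (f j <= n.+1).
  exists a.-1; rewrite /f ltn_predL a0 prednK // subnn add0n ltnS.
  rewrite (@eq_in_count _ _ pred0) ?count_pred0 // => b /s_lt ba /=.
  by rewrite leqNgt ba.
case: (ex_minnP ex) => -[|j] /andP[ja fj] jmin.
  have [_ /eqP] := f_hook _ ja; apply; apply/eqP; rewrite eqn_leq fj /=.
  by rewrite /f subn1 ltnS -ltnS; apply: leq_trans lna _; case: (a) a0 => // ? _;
     rewrite /= ltnS leq_addr.
have fj' : n.+1 < f j.
  rewrite ltnNge; apply/negP => h; have := jmin j.
  by rewrite h (ltnW ja) ltnn => /(_ isT).
have step : f j <= (f j.+1).+2.
  rewrite /f !ltnS.
  have -> : a - j.+1 = (a - j.+2).+1 by rewrite -subSn.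
  rewrite addSn ltnS -addnS leq_add2l.
  have -> : count (fun p => j < p) s =
            count (fun p => j.+1 < p) s + count (pred1 j.+1) s.
    elim: (s) => //= p q ->; rewrite addnACA; congr (_ + _).
    by case: (ltngtP j.+1 p).
  by rewrite count_uniq_mem // -[X in _ <= X]addn1 leq_add2l leq_b1.
have [h1 h2] := f_hook _ ja.
have : n <= f j.+1 by rewrite -2!ltnS; exact: leq_trans fj' step.
rewrite leq_eqVlt eq_sym (negbTE h1) /= => nf.
by move: h2; rewrite eqn_leq fj nf.
Qed.

Lemma finite_distinct_cores_set n : finite_set (distinct_cores_set n n.+1).
Proof.
pose nilp : partition := @Partition [::] isT.
pose g (S : {set 'I_n.+1}) : partition :=
  insubd nilp (sort geq [seq val i | i <- enum S]).
apply: (@sub_finite_set _ _ (g @` setT)%classic); last exact/finite_image/finite_finset.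
move=> la cla; exists [set i : 'I_n.+1 | val i \in (la : seq nat)]%SET => //.
have la_le b : b \in (la : seq nat) -> b < n.+1.
  have := distinct_core_head_le cla; case: (la) => -[|a s] //= /andP[pth _] an.
  have geq_trans : transitive geq by move=> x y z /= xy yz; exact: leq_trans yz xy.
  rewrite inE ltnS => /orP[/eqP-> //|bs].
  by apply: leq_trans an; have /allP/(_ _ bs) := order_path_min geq_trans pth.
have E : sort geq [seq val i | i <- enum [set i : 'I_n.+1 | val i \in (la : seq nat)]%SET]
         = la.
  apply: (@sorted_eq _ geq).
  - by move=> x y z /= xy yz; exact: leq_trans yz xy.
  - by move=> x y; rewrite andbC => /anti_leq.
  - by apply: sort_sorted => x y; exact: leq_total.
  - by case: (la) => s /= /andP[].
  rewrite perm_sort; apply: uniq_perm.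
  - by rewrite map_inj_uniq ?enum_uniq //; exact: val_inj.
  - by case: cla.
  move=> b; apply/mapP/idP => [[i + ->]|bla]; first by rewrite mem_enum inE.
  by exists (Ordinal (la_le _ bla)) => //; rewrite mem_enum inE.
by apply: val_inj; rewrite /g E val_insubd; case: (la) => s /= ->.
Qed.

Lemma distinct_coresP n (la : partition) :
  la \in distinct_cores n n.+1 <->
  [/\ is_core n la, is_core n.+1 la & uniq la].
Proof.
rewrite /distinct_cores in_fset_set; last exact: finite_distinct_cores_set.
by split=> [/set_mem|h]; [|apply/mem_set].
Qed.

Lemma distinct_cores_neq0 n : distinct_cores n n.+1 != fset0.
Proof. by apply/fset0Pn; exists (@Partition [::] isT); apply/distinct_coresP. Qed.

(* Main.v *)
(** A partition with distinct parts is an (n, n+1)-core iff the hook of its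
    corner box is shorter than n, i.e. iff it is empty or (largest part) +
    (number of parts) <= n.  Such partitions satisfy a Fibonacci recursion: either
    they satisfy the bound for n - 1, or their corner hook is n - 1 and removing
    the first row gives an arbitrary one for n - 2.  Along this recursion, the
    number of parts L and the sum A of the first column hook lengths grow by
    constants, so their first two moments satisfy Fibonacci recurrences with small
    driving terms.  With p = (5 - sqrt 5) / 10, the root of 5 p (1 - p) = 1 making
    the driving terms of the means of L - p n and A - p n^2 / 2 vanish to leading
    order, these deviations have means O(1) and O(n) and second moments O(n) and
    O(n^3).  As the size is X = A - L (L - 1) / 2, the deviation Y = X - n^2 / 10
    has mean O(n) and second moment O(n^3).  Since 0 <= X <= n^2, a Taylor
    expansion of X^k at n^2 / 10 to first order concludes. *)
Require Import Defs.
From mathcomp Require Import all_boot all_order all_algebra finmap.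
From mathcomp Require Import boolp classical_sets functions cardinality reals.
From mathcomp Require Import topology normedtype landau.
From mathcomp Require Import zify ring lra.
Import Order.TTheory GRing.Theory Num.Theory.
Import numFieldNormedType.Exports.
Local Open Scope nat_scope.
Set Implicit Arguments.
Unset Strict Implicit.
Unset Printing Implicit Defensive.

(** * Distinct-part cores as a list with a Fibonacci recursion *)

(** The part put in front makes (first part) + (number of parts) equal to the new bound [m.+2]
    exactly. For bound 1 no nonempty list fits, hence the empty branch. *)
Fixpoint short_strict (n : nat) : seq (seq nat) :=
  if n is n'.+1 then
    short_strict n' ++
      (if n' is m.+1 then [seq (m.+1 - size s) :: s | s <- short_strict m]
       else [::])
  else [:: [::]].

Lemma short_strictSS n :
  short_strict n.+2 =
  short_strict n.+1 ++ [seq (n.+1 - size s) :: s | s <- short_strict n].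
Proof. by []. Qed.

Lemma nat_ind2 (P : nat -> Prop) :
  P 0 -> P 1 -> (forall n, P n -> P n.+1 -> P n.+2) -> forall n, P n.
Proof.
move=> P0 P1 PS n; suff [] : P n /\ P n.+1 by [].
by elim: n => [//|n [Pn PSn]]; split=> //; exact: PS.
Qed.

(** When the bound [n.+2] is attained by [a :: t], one has [a = n.+1 - size t]. If [t] starts with
    [b], then [b + size t <= n] says exactly [b < a], so every tail from [short_strict n] gives a
    strictly decreasing list. *)
Lemma mem_short_strict n s :
  (s \in short_strict n) =
  [&& sorted gtn s, all (leq 1) s & (s == [::]) || (head 0 s + size s <= n)].
Proof.
elim/nat_ind2: n s => [[|[|a] t]|[|[|a] t]|n IH IH1 s].
- by [].
- by rewrite /= inE !andbF.
- by rewrite /= inE /= addSn !andbF.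
- by [].
- by rewrite /= inE !andbF.
- by rewrite /= inE /= addSn addnS ltnS ltn0 !andbF.
rewrite short_strictSS mem_cat IH1; case: s => [//|a t].
have -> : (a :: t \in [seq (n.+1 - size s) :: s | s <- short_strict n]) =
          (t \in short_strict n) && (a == n.+1 - size t).
  apply/mapP/andP => [[s sn [-> ->]]|[tn /eqP->]]; first by rewrite eqxx.
  by exists t.
rewrite IH; case: t => [|b u] /=; first by lia.
case: (path gtn b u) => /=; last by rewrite !andbF.
case: (all _ u) => /=; last by rewrite !andbF.
lia.
Qed.

(** The two branches are disjoint: only the second attains the bound. *)
Lemma uniq_short_strict n : uniq (short_strict n).
Proof.
elim/nat_ind2: n => // n un un1.
rewrite short_strictSS cat_uniq un1 map_inj_uniq ?un => [|s t [] //].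
rewrite andbT; apply/hasPn => _ /mapP[s sn ->]; move: sn.
rewrite !mem_short_strict; case: s => [|b u] /=; lia.
Qed.

Lemma size_short_strict_le n s : s \in short_strict n -> size s <= n.
Proof. by rewrite mem_short_strict => /and3P[_ _]; case: s => //=; lia. Qed.

Lemma sumn_short_strict_le n s : s \in short_strict n -> sumn s <= n ^ 2.
Proof.
elim/nat_ind2: n s => [s|s|n IH IH1 s].
- by rewrite inE => /eqP->.
- by rewrite inE => /eqP->.
rewrite short_strictSS mem_cat => /orP[/IH1|/mapP[t /IH tn ->] /=]; nia.
Qed.

(* Along the first row, hook lengths decrease to 1 by steps of at most 2, so
   they cannot jump over the two forbidden values n and n + 1. *)
Lemma distinct_core_perimeter n (la : Defs.partition) :
  distinct_cores_set n n.+1 la ->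
  (la == [::] :> seq nat) || (head 0 la + size la <= n).
Proof.
case: la => [[|a s] laP] [] //=; set la := Partition _ => cn cn1 /andP[ans us].
have := laP; rewrite /is_partition /= => /andP[pth /andP[a0 pos]].
have s_lt b : b \in s -> b < a.
  move=> bs; rewrite ltn_neqAle; apply/andP; split.
    by apply: contraNneq ans => <-.
  have geq_trans : transitive geq by move=> x y z /= xy yz; exact: leq_trans yz xy.
  by have /allP/(_ _ bs) := order_path_min geq_trans pth.
pose f j := (a - j.+1 + count (fun p => j < p) s).+1.
have f_hook j : j < a -> f j != n /\ f j != n.+1.
  move=> ja; have := cn 0 j isT ja; have := cn1 0 j isT ja.
  rewrite /hook_length /arm /leg /= drop0 -/(f j) => h1 h2.
  by split; apply: contraTneq isT => e; move: h1 h2; rewrite e dvdnn ?andbF.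
have f0 : f 0 = a + size s.
  rewrite /f; have /eqP -> : count (fun p => 0 < p) s == size s by rewrite -all_count.
  lia.
have step j : j.+1 < a -> f j <= (f j.+1).+2.
  move=> ja; rewrite /f.
  have -> : count (fun p => j < p) s =
            count (fun p => j.+1 < p) s + count (pred1 j.+1) s.
    elim: (s) => //= p q ->; rewrite addnACA; congr (_ + _).
    by case: (ltngtP j.+1 p).
  by rewrite count_uniq_mem //; case: (_ \in _); lia.
suff far j : j < a -> n <= f 0 -> n.+1 < f j.
  rewrite leqNgt; apply/negP => h.
  have := far a.-1; have -> : f a.-1 = 1.
    rewrite /f (@eq_in_count _ _ pred0) ?count_pred0 => [|b /s_lt /=]; lia.
  by rewrite f0; lia.
move=> ja nf; elim: j ja => [|j IH] ja.
  by have [] := f_hook _ ja; lia.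
by have := IH (ltnW ja); have := step _ ja; have [] := f_hook _ ja; lia.
Qed.

Lemma is_partition_uniq (s : seq nat) :
  is_partition s && uniq s = sorted gtn s && all (leq 1) s.
Proof.
by rewrite gtn_sorted_uniq_geq /is_partition andbC andbA.
Qed.

(** The corner hook is the longest, and its length [head 0 la + size la - 1] is below [n]. *)
Lemma short_is_core n t (la : Defs.partition) :
  sorted geq la -> head 0 la + size la <= n -> n <= t -> is_core t la.
Proof.
move=> srt per nt i j ila jla; apply: contraL (isT : true) => /dvdn_leq.
have ge0 : nth 0 la i <= head 0 la.
  case: (la : seq nat) srt ila {per jla} => //= a s pth; case: i => //= i il.
  have geq_trans : transitive geq by move=> x y z /= xy yz; exact: leq_trans yz xy.
  by have /allP/(_ _ (mem_nth 0 il)) := order_path_min geq_trans pth.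
have : leg la i j <= size la - i.+1 by rewrite -size_drop count_size.
rewrite /hook_length /arm; lia.
Qed.

Lemma perm_distinct_cores n :
  perm_eq [seq val la | la <- distinct_cores n n.+1] (short_strict n).
Proof.
apply: uniq_perm.
- by rewrite map_inj_uniq ?fset_uniq //; exact: val_inj.
- exact: uniq_short_strict.
move=> s; rewrite mem_short_strict andbA -is_partition_uniq.
apply/mapP/andP => [[la laD ->]|[/andP[sP su] per]].
  case/distinct_coresP: laD => cn cn1 u; split; last exact: distinct_core_perimeter.
  by rewrite u andbT; case: (la).
exists (Partition sP) => //; apply/distinct_coresP.
have [srt _] := andP sP.
case/orP: per => [/eqP e|per]; last by split=> //; apply: (@short_is_core n).
by split=> // i j /=; have -> : size s = 0 by rewrite e.
Qed.

Local Open Scope classical_set_scope.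
Local Open Scope ring_scope.

(** * Sums over the list, and three auxiliary estimates *)

Definition short_sum {R : realType} n (f : seq nat -> R) : R :=
  \sum_(s <- short_strict n) f s.

Definition short_count {R : realType} n : R := (size (short_strict n))%:R.

Lemma short_sumSS (R : realType) n (f : seq nat -> R) :
  short_sum n.+2 f =
  short_sum n.+1 f + short_sum n (fun s => f ((n.+1 - size s)%N :: s)).
Proof. by rewrite /short_sum short_strictSS big_cat big_map. Qed.

Lemma short_countSS (R : realType) n :
  @short_count R n.+2 = short_count n.+1 + short_count n.
Proof. by rewrite /short_count short_strictSS size_cat size_map natrD. Qed.

Lemma eq_short_sum (R : realType) n (f g : seq nat -> R) :
  {in short_strict n, f =1 g} -> short_sum n f = short_sum n g.
Proof. by move=> fg; exact: eq_big_seq. Qed.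

Lemma le_short_sum (R : realType) n (f g : seq nat -> R) :
  {in short_strict n, forall s, f s <= g s} -> short_sum n f <= short_sum n g.
Proof.
by move=> fg; rewrite /short_sum big_seq [leRHS]big_seq; apply: ler_sum => s; exact: fg.
Qed.

Lemma short_sumD (R : realType) n (f g : seq nat -> R) :
  short_sum n (fun s => f s + g s) = short_sum n f + short_sum n g.
Proof. exact: big_split. Qed.

Lemma short_sumZ (R : realType) n a (f : seq nat -> R) :
  short_sum n (fun s => a * f s) = a * short_sum n f.
Proof. by rewrite /short_sum big_distrr. Qed.

Lemma short_sum_cst (R : realType) n (a : R) :
  short_sum n (fun=> a) = a * short_count n.
Proof. by rewrite /short_sum big_const_seq count_predT iter_addr_0 mulr_natr. Qed.

Lemma short_sum_shift (R : realType) n (f : seq nat -> R) b :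
  short_sum n (fun s => f s + b) = short_sum n f + b * short_count n.
Proof. by rewrite short_sumD short_sum_cst. Qed.

Lemma short_sum_shift_sqr (R : realType) n (f : seq nat -> R) b :
  short_sum n (fun s => (f s + b) ^+ 2) =
  short_sum n (fun s => f s ^+ 2) + 2 * b * short_sum n f + b ^+ 2 * short_count n.
Proof.
rewrite -short_sumZ -short_sum_cst -!short_sumD.
by apply: eq_short_sum => s _; ring.
Qed.

Lemma short_count_ge (R : realType) n : n%:R <= @short_count R n.
Proof.
rewrite ler_nat; suff : (n <= size (short_strict n) /\ 0 < size (short_strict n))%N by case.
elim/nat_ind2: n => // n [a b] [c d].
by rewrite short_strictSS size_cat size_map; split; lia.
Qed.

Lemma short_count_gt0 (R : realType) n : 0 < @short_count R n.
Proof.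
rewrite ltr0n; elim/nat_ind2: n => // n _ h.
by rewrite short_strictSS size_cat ltn_addr.
Qed.

(** Since [short_count] obeys the same recurrence, driving terms of order [n ^ d] per element
    accumulate to one more power of [n]. The induction closes by
    [(n+2)^d * (n+3) <= (n+3)^(d+1)]. *)
Lemma fib_recurrence_bound (R : realType) (a : nat -> R) (K : R) d :
  0 <= K -> a 0 <= K -> a 1 <= K ->
  (forall n, a n.+2 <= a n.+1 + a n + K * n.+2%:R ^+ d * short_count n.+2) ->
  forall n, a n <= K * n.+1%:R ^+ d.+1 * short_count n.
Proof.
move=> K0 a0 a1 aS; elim/nat_ind2 => [||n IH IH1].
- by rewrite expr1n !mulr1.
- apply: le_trans a1 _; rewrite /short_count /= mulr1 ler_peMr //.
  by rewrite exprn_ege1 // ler1n.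
apply: le_trans (aS n) _.
have c0 := short_count_gt0 R n; have c1 := short_count_gt0 R n.+1.
have p1 : n.+1%:R ^+ d.+1 <= n.+2%:R ^+ d.+1 :> R by rewrite lerXn2r ?nnegrE ?ler_nat.
have p2 : n.+2%:R ^+ d <= n.+3%:R ^+ d :> R by rewrite lerXn2r ?nnegrE ?ler_nat.
have {}IH : a n <= K * n.+2%:R ^+ d.+1 * short_count n.
  by apply: le_trans IH _; rewrite ler_wpM2r ?(ltW c0) // ler_wpM2l.
apply: le_trans (lerD (lerD IH1 IH) (lexx _)) _.
rewrite -mulrDr -short_countSS -mulrDl ler_wpM2r ?(ltW (short_count_gt0 _ _)) //.
rewrite -mulrDr ler_wpM2l // exprS [leRHS]exprS -[X in _ + X]mul1r -mulrDl natr1.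
by rewrite ler_wpM2l.
Qed.

(** The factor [M ^+ 2] avoids the exponent [k - 2]. The remainder for [k.+1] is [x] times that for
    [k] plus [k * a^(k-1) * (x - a)^2], and [k^2 + k <= (k+1)^2]. *)
Lemma Taylor_expn_bound (R : realType) (a x M : R) k :
  0 <= a <= M -> 0 <= x <= M ->
  M ^+ 2 * `|x ^+ k - a ^+ k - k%:R * a ^+ k.-1 * (x - a)| <=
  k%:R ^+ 2 * M ^+ k * (x - a) ^+ 2.
Proof.
move=> /andP[a0 aM] /andP[x0 xM]; have M0 := le_trans a0 aM.
elim: k => [|k IH].
  by rewrite !expr0 subrr !mul0r subr0 normr0 mulr0 expr0n !mul0r.
have -> : x ^+ k.+1 - a ^+ k.+1 - k.+1%:R * a ^+ k * (x - a) =
    x * (x ^+ k - a ^+ k - k%:R * a ^+ k.-1 * (x - a)) +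
    k%:R * a ^+ k.-1 * (x - a) ^+ 2.
  by case: k {IH} => [|k] /=; rewrite ?exprS -?natr1; ring.
set r := (x ^+ k - _ - _) in IH *; set y := (x - a) ^+ 2 in IH *.
have y0 : 0 <= y by exact: sqr_ge0.
apply: (@le_trans _ _ (M * (M ^+ 2 * `|r|) + k%:R * M ^+ k.+1 * y)).
  apply: le_trans (ler_wpM2l (sqr_ge0 M) (ler_normD _ _)) _.
  rewrite mulrDr; apply: lerD.
    by rewrite normrM (ger0_norm x0) mulrCA ler_wpM2r // mulr_ge0 // sqr_ge0.
  rewrite [X in _ * X]ger0_norm; last by rewrite mulr_ge0 // mulr_ge0 // exprn_ge0.
  rewrite mulrA ler_wpM2r // mulrCA; case: k {IH r} => [|k] /=.
    by rewrite !mul0r.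
  by rewrite ler_wpM2l // -[k.+2]addn2 exprD mulrC ler_wpM2r ?sqr_ge0 // lerXn2r.
apply: le_trans (lerD (ler_wpM2l M0 IH) (lexx _)) _.
have -> : M * (k%:R ^+ 2 * M ^+ k * y) + k%:R * M ^+ k.+1 * y =
          (k%:R ^+ 2 + k%:R) * (M ^+ k.+1 * y) by rewrite (exprS M k); ring.
rewrite -mulrA ler_wpM2r ?(mulr_ge0 (exprn_ge0 _ M0) y0) // -natr1.
have : 0 <= k%:R :> R by []. nra.
Qed.

(** The relation on [p] makes this combination an eigenvector of the Fibonacci step: it is
    multiplied by [- (2 - 5 * p)], of absolute value at most 1. *)
Lemma fib_ratio_discrepancy (R : realType) (p : R) n :
  5 * p * (1 - p) = 1 -> 1 / 5 <= p <= 1 / 3 ->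
  `|p * short_count n.+1 - (1 - 2 * p) * short_count n| <= 1.
Proof.
move=> pE pb; elim: n => [|n IH].
  by rewrite /short_count /= ler_norml; lra.
have -> : p * short_count n.+2 - (1 - 2 * p) * short_count n.+1 =
    - (2 - 5 * p) * (p * short_count n.+1 - (1 - 2 * p) * short_count n).
  rewrite short_countSS; apply/eqP; rewrite -subr_eq0.
  set c1 := short_count n.+1; set c0 := short_count n.
  by rewrite [X in X == _](_ : _ = (5 * p * (1 - p) - 1) * (c1 + 2 * c0));
    [rewrite pE subrr mul0r|ring].
rewrite normrM normrN (@ger0_norm _ (2 - 5 * p)); last by lra.
by apply: mulr_ile1 => //; lra.
Qed.

(** * First two moments of the number of parts and of the first column hook sum *)

Definition size_dev {R : realType} (p : R) n (s : seq nat) : R :=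
  (size s)%:R - p * n%:R.

(* sumn s + (size s choose 2) is the sum of the hook lengths of the first
   column, which, unlike sumn s itself, grows by a constant under the second
   branch of the recursion of short_strict. *)
Definition hooks_dev {R : realType} (p : R) n (s : seq nat) : R :=
  (sumn s)%:R + (size s)%:R * ((size s)%:R - 1) / 2 - p * n%:R ^+ 2 / 2.

Lemma size_devS (R : realType) (p : R) n s :
  size_dev p n.+1 s = size_dev p n s + - p.
Proof. by rewrite /size_dev -natr1; ring. Qed.

Lemma size_dev_cons (R : realType) (p : R) n a s :
  size_dev p n.+2 (a :: s) = size_dev p n s + (1 - 2 * p).
Proof. by rewrite /size_dev /= -!natr1; ring. Qed.

Lemma hooks_devS (R : realType) (p : R) n s :
  hooks_dev p n.+1 s = hooks_dev p n s + - (p * (2 * n%:R + 1) / 2).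
Proof. by rewrite /hooks_dev -natr1; field. Qed.

Lemma hooks_dev_cons (R : realType) (p : R) n s : (size s <= n.+1)%N ->
  hooks_dev p n.+2 ((n.+1 - size s)%N :: s) =
  hooks_dev p n s + (n%:R + 1) * (1 - 2 * p).
Proof.
by move=> sn; rewrite /hooks_dev /= natrD natrB // -!natr1; field.
Qed.

(** The [- 1] strengthens the induction: adding the two previous bounds leaves a slack of 1, which
    absorbs the driving term. *)
Lemma size_dev_sum (R : realType) (p : R) n :
  5 * p * (1 - p) = 1 -> 1 / 5 <= p <= 1 / 3 ->
  `|short_sum n (size_dev p n)| <= 2 * short_count n - 1.
Proof.
move=> pE pb; elim/nat_ind2: n => [||n IH IH1].
- by rewrite /short_sum /short_count /= big_seq1 /size_dev /= ler_norml; lra.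
- by rewrite /short_sum /short_count /= big_seq1 /size_dev /= ler_norml; lra.
have := fib_ratio_discrepancy n pE pb.
have -> : short_sum n.+2 (size_dev p n.+2) =
    short_sum n.+1 (size_dev p n.+1) + short_sum n (size_dev p n)
    + - (p * short_count n.+1 - (1 - 2 * p) * short_count n).
  rewrite short_sumSS.
  under eq_short_sum do rewrite size_devS.
  under [X in _ + X]eq_short_sum do rewrite size_dev_cons.
  by rewrite !short_sum_shift; ring.
move: IH IH1; rewrite short_countSS !ler_norml; lra.
Qed.

(** Expanding the shifted squares leaves cross terms that [size_dev_sum] bounds by a multiple of the
    count. *)
Lemma size_dev_sqr_sum (R : realType) (p : R) n :
  5 * p * (1 - p) = 1 -> 1 / 5 <= p <= 1 / 3 ->
  short_sum n (fun s => size_dev p n s ^+ 2) <= 5 * n.+1%:R * short_count n.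
Proof.
move=> pE pb; rewrite -[n.+1%:R]expr1; move: n; apply: fib_recurrence_bound => //.
- by rewrite /short_sum /= big_seq1 /size_dev /=; nra.
- by rewrite /short_sum /= big_seq1 /size_dev /=; nra.
move=> n; rewrite short_sumSS expr0 mulr1.
under eq_short_sum do rewrite size_devS.
under [X in _ + X <= _]eq_short_sum do rewrite size_dev_cons.
rewrite !short_sum_shift_sqr short_countSS.
have := size_dev_sum n pE pb; have := size_dev_sum n.+1 pE pb.
have := short_count_gt0 R n; have := short_count_gt0 R n.+1.
rewrite !ler_norml; set t1 := short_sum n.+1 (size_dev _ _).
set t0 := short_sum n (size_dev _ _).
set c1 := short_count n.+1; set c0 := short_count n => h1 h0 /andP[a1 b1] /andP[a0 b0].
have : - p * t1 <= p * (2 * c1) by nra.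
have : (1 - 2 * p) * t0 <= (1 - 2 * p) * (2 * c0) by nra.
have : (1 - 2 * p) ^+ 2 * c0 <= c0 by nra.
have : (- p) ^+ 2 * c1 <= c1 by nra.
nra.
Qed.

Lemma hooks_dev_sum (R : realType) (p : R) n :
  5 * p * (1 - p) = 1 -> 1 / 5 <= p <= 1 / 3 ->
  `|short_sum n (hooks_dev p n)| <= 2 * n.+1%:R * short_count n.
Proof.
move=> pE pb; rewrite -[n.+1%:R]expr1; move: n; apply: fib_recurrence_bound => //.
- by rewrite /short_sum /= big_seq1 /hooks_dev /= ler_norml; lra.
- by rewrite /short_sum /= big_seq1 /hooks_dev /= ler_norml; lra.
move=> n; rewrite short_sumSS expr0 mulr1.
under eq_short_sum do rewrite hooks_devS.
under [X in _ + X]eq_short_sum => s /size_short_strict_le /leqW sn do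
  rewrite hooks_dev_cons //.
rewrite (short_sum_shift _ (hooks_dev p n.+1)) (short_sum_shift _ (hooks_dev p n)).
have := fib_ratio_discrepancy n pE pb.
have := short_count_ge R n.+2; have := short_count_gt0 R n; have := short_count_gt0 R n.+1.
rewrite short_countSS -(natr1 n.+1) -(natr1 n).
set t1 := short_sum n.+1 _; set t0 := short_sum n _.
set c1 := short_count n.+1; set c0 := short_count n; set m : R := n%:R => h1 h0 hm e.
have m0 : 0 <= m by exact: ler0n.
(* The leading driving term is [m + 1] times the ratio discrepancy, hence at most [m + 1], which is
   below [short_count n.+2]. *)
have -> : t1 + - (p * (2 * (m + 1) + 1) / 2) * c1 + (t0 + (m + 1) * (1 - 2 * p) * c0) =
   t1 + t0 + (- ((m + 1) * (p * c1 - (1 - 2 * p) * c0)) - p / 2 * c1) by field.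
apply: le_trans (ler_normD _ _) _; apply: lerD; first exact: ler_normD.
move: e; set e := p * c1 - _; rewrite !ler_norml => /andP[e1 e2].
by apply/andP; split; nra.
Qed.

(** The shifts and the mean are both [O(n)], so the driving terms are of order [n ^ 2] per
    element. *)
Lemma hooks_dev_sqr_sum (R : realType) (p : R) n :
  5 * p * (1 - p) = 1 -> 1 / 5 <= p <= 1 / 3 ->
  short_sum n (fun s => hooks_dev p n s ^+ 2) <= 5 * n.+1%:R ^+ 3 * short_count n.
Proof.
move=> pE pb; move: n; apply: fib_recurrence_bound => //.
- by rewrite /short_sum /= big_seq1 /hooks_dev /=; nra.
- by rewrite /short_sum /= big_seq1 /hooks_dev /=; nra.
move=> n; rewrite short_sumSS.
under eq_short_sum do rewrite hooks_devS.
under [X in _ + X <= _]eq_short_sum => s /size_short_strict_le /leqW sn do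
  rewrite hooks_dev_cons //.
rewrite !short_sum_shift_sqr short_countSS.
have := hooks_dev_sum n pE pb; have := hooks_dev_sum n.+1 pE pb.
have := short_count_gt0 R n; have := short_count_gt0 R n.+1.
rewrite !ler_norml -(natr1 n.+1) -(natr1 n); set t1 := short_sum n.+1 (hooks_dev _ _).
set t0 := short_sum n (hooks_dev _ _).
set c1 := short_count n.+1; set c0 := short_count n; set m : R := n%:R.
move=> h1 h0 /andP[a1 b1] /andP[a0 b0].
have m0 : 0 <= m by exact: ler0n.
set b : R := p * (2 * (m + 1) + 1) / 2; set d : R := (m + 1) * (1 - 2 * p).
have b_ge0 : 0 <= b by rewrite /b; nra.
have b_le : b <= (m + 2) / 2 by rewrite /b; nra.
have d_ge0 : 0 <= d by rewrite /d; nra.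
have d_le : d <= m + 1 by rewrite /d; nra.
have : - b * t1 <= (m + 2) / 2 * (2 * (m + 2) * c1).
  by apply: (@le_trans _ _ (b * (2 * (m + 1 + 1) * c1))); [nra|apply: ler_pM; nra].
have : d * t0 <= (m + 1) * (2 * (m + 1) * c0).
  by apply: (@le_trans _ _ (d * (2 * (m + 1) * c0))); [nra|apply: ler_wpM2r; nra].
have : b ^+ 2 * c1 <= (m + 2) ^+ 2 * c1 by apply: ler_wpM2r; [exact: ltW|nra].
have : d ^+ 2 * c0 <= (m + 1) ^+ 2 * c0 by apply: ler_wpM2r; [exact: ltW|nra].
have : (m + 1) ^+ 2 * c0 <= (m + 2) ^+ 2 * c0 by apply: ler_wpM2r; [exact: ltW|nra].
have : 0 <= m ^+ 2 * c0 by rewrite mulr_ge0 ?sqr_ge0 ?ltW.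
nra.
Qed.

(** * Mean and second moment of the deviation of the size *)

(** The interval selects the smaller root of the quadratic. *)
Lemma exists_sparse_density (R : realType) :
  exists2 p : R, 5 * p * (1 - p) = 1 & 1 / 5 <= p <= 1 / 3.
Proof.
have r5 : Num.sqrt 5 ^+ 2 = 5 :> R by rewrite sqr_sqrtr.
have r0 : 0 <= Num.sqrt 5 :> R by exact: sqrtr_ge0.
by exists ((5 - Num.sqrt 5) / 10); [|apply/andP; split]; nra.
Qed.

(** The constant 1/10 arises here: the coefficient of [n ^ 2] is
    [p / 2 - p ^ 2 / 2 = p * (1 - p) / 2]. *)
Lemma sumn_dev (R : realType) (p : R) n s : 5 * p * (1 - p) = 1 ->
  (sumn s)%:R - n%:R ^+ 2 / 10 =
  hooks_dev p n s + - (size_dev p n s ^+ 2 / 2) + - (p * n%:R * size_dev p n s)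
  + size_dev p n s / 2 + p * n%:R / 2.
Proof.
move=> pE; apply/eqP; rewrite -subr_eq0 /hooks_dev /size_dev.
set x := (sumn s)%:R; set l := (size s)%:R; set m := n%:R.
by rewrite [X in X == _](_ : _ = (5 * p * (1 - p) - 1) * (m ^+ 2 / 10));
  [rewrite pE subrr mul0r|field].
Qed.

(** The delicate term is [p * n * size_dev]: it stays [O(n)] on average because [size_dev] has mean
    [O(1)]. *)
Lemma sumn_dev_sum (R : realType) n :
  `|short_sum n (fun s => (sumn s)%:R - n%:R ^+ 2 / 10 : R)| <=
  10 * n.+1%:R * short_count n.
Proof.
have [p pE pb] := exists_sparse_density R.
have -> : short_sum n (fun s => (sumn s)%:R - n%:R ^+ 2 / 10) =
    short_sum n (hooks_dev p n) + - (1 / 2) * short_sum n (fun s => size_dev p n s ^+ 2)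
    + (1 / 2 - p * n%:R) * short_sum n (size_dev p n) + p * n%:R / 2 * short_count n.
  rewrite -short_sum_cst -!short_sumZ -!short_sumD.
  by apply: eq_short_sum => s _; rewrite (sumn_dev n s pE); field.
have := size_dev_sum n pE pb; have := size_dev_sqr_sum n pE pb.
have := hooks_dev_sum n pE pb; have := short_count_gt0 R n.
have : 0 <= short_sum n (fun s => size_dev p n s ^+ 2).
  by apply: sumr_ge0 => s _; exact: sqr_ge0.
rewrite -(natr1 n); set u := short_sum n (hooks_dev p n).
set v2 := short_sum n (fun s => size_dev p n s ^+ 2).
set v := short_sum n (size_dev p n); set c := short_count n; set m : R := n%:R.
move=> v2_ge0 c0 ub v2_le vb.
have m0 : 0 <= m by exact: ler0n.
have mvb : `|p * m * v| <= p * m * (2 * c).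
  rewrite normrM ger0_norm; last by nra.
  by apply: ler_wpM2l; [nra|lra].
have pmc : p * m * c <= m * c by nra.
have mc : 0 <= m * c by nra.
move: ub vb mvb; rewrite !ler_norml => /andP[u1 u2] /andP[v1 v3] /andP[w1 w2].
have pmc0 : 0 <= p * m * c by nra.
apply/andP; split; nra.
Qed.

Lemma sumn_dev_sqr_sum (R : realType) n :
  short_sum n (fun s => ((sumn s)%:R - n%:R ^+ 2 / 10) ^+ 2 : R) <=
  70 * n.+1%:R ^+ 3 * short_count n.
Proof.
have [p pE pb] := exists_sparse_density R.
have v2 := size_dev_sqr_sum n pE pb; have u2 := hooks_dev_sqr_sum n pE pb.
have c0 := short_count_gt0 R n; have m0 : 0 <= n%:R :> R by exact: ler0n.
(* Cauchy-Schwarz on the five terms of [sumn_dev], with fourth powers reduced by [|size_dev| <= n];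
   7 and 3 round up [5/4 + 5] and [5/4 + 5/4]. *)
apply: (@le_trans _ _ (short_sum n (fun s => 5 * hooks_dev p n s ^+ 2 +
    7 * n%:R ^+ 2 * size_dev p n s ^+ 2 + 3 * n%:R ^+ 2))).
  apply: le_short_sum => s sn; rewrite (sumn_dev n s pE).
  set u := hooks_dev p n s.
  have : `|size_dev p n s| <= n%:R.
    have : (size s)%:R <= n%:R :> R by rewrite ler_nat size_short_strict_le.
    have : 0 <= (size s)%:R :> R by exact: ler0n.
    by rewrite /size_dev ler_norml; nra.
  rewrite ler_norml; set v := size_dev p n s; move: m0; set m : R := n%:R => m0 vm.
  have vm2 : v ^+ 2 <= m ^+ 2 by nra.
  have v0 : 0 <= v ^+ 2 by exact: sqr_ge0.
  have v4 : v ^+ 2 * v ^+ 2 <= m ^+ 2 * v ^+ 2 by apply: ler_wpM2r.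
  have p2 : p ^+ 2 <= 1 by nra.
  have p2v : p ^+ 2 * (m ^+ 2 * v ^+ 2) <= m ^+ 2 * v ^+ 2.
    by rewrite ler_piMl // mulr_ge0 ?sqr_ge0.
  have p2m : p ^+ 2 * m ^+ 2 <= m ^+ 2 by rewrite ler_piMl ?sqr_ge0.
  have sq5 (a b c d e : R) : (a + b + c + d + e) ^+ 2 <=
      5 * (a ^+ 2 + b ^+ 2 + c ^+ 2 + d ^+ 2 + e ^+ 2).
    rewrite -subr_ge0.
    have -> : 5 * (a ^+ 2 + b ^+ 2 + c ^+ 2 + d ^+ 2 + e ^+ 2) -
        (a + b + c + d + e) ^+ 2 =
      (a - b) ^+ 2 + (a - c) ^+ 2 + (a - d) ^+ 2 + (a - e) ^+ 2 + (b - c) ^+ 2 +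
      (b - d) ^+ 2 + (b - e) ^+ 2 + (c - d) ^+ 2 + (c - e) ^+ 2 + (d - e) ^+ 2.
      by ring.
    by rewrite !addr_ge0 ?sqr_ge0.
  apply: le_trans (sq5 _ _ _ _ _) _.
  have -> : 5 * (u ^+ 2 + (- (v ^+ 2 / 2)) ^+ 2 + (- (p * m * v)) ^+ 2 + (v / 2) ^+ 2 +
      (p * m / 2) ^+ 2) = 5 * u ^+ 2 + 5 / 4 * (v ^+ 2 * v ^+ 2) +
      5 * (p ^+ 2 * (m ^+ 2 * v ^+ 2)) + 5 / 4 * v ^+ 2 + 5 / 4 * (p ^+ 2 * m ^+ 2).
    by field.
  have := sqr_ge0 (m * v); rewrite exprMn; have := sqr_ge0 m; lra.
rewrite short_sum_shift short_sumD !short_sumZ.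
move: v2 u2 c0 m0; rewrite -(natr1 n).
set v2 := short_sum _ _; set u2 := short_sum _ _; set c := short_count n.
set m : R := n%:R => hv hu c0 m0.
have : m ^+ 2 * v2 <= m ^+ 2 * (5 * (m + 1) * c) by rewrite ler_wpM2l ?sqr_ge0.
have : 0 <= m * c by nra.
have : 0 <= m ^+ 2 * c by nra.
have : 0 <= m ^+ 3 * c by rewrite mulr_ge0 ?exprn_ge0 // ltW.
nra.
Qed.

(** * The k-th moment *)

(** The linear Taylor term costs [n^(2k-2)] times the mean deviation [O(n)], the remainder
    [n^(2k-4)] times the second moment [O(n^3)]. *)
Lemma short_sum_expn_bound (R : realType) k n : (0 < k)%N -> (0 < n)%N ->
  `|short_sum n (fun s => (sumn s)%:R ^+ k) -
    (1 / 10) ^+ k * n%:R ^+ (2 * k) * short_count n| <=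
  (20 * k%:R + 560 * k%:R ^+ 2) * n%:R ^+ (2 * k - 1) * short_count n :> R.
Proof.
move=> k0 n0; pose m : R := n%:R; pose a : R := m ^+ 2 / 10; pose M : R := m ^+ 2.
have m1 : 1 <= m by rewrite ler1n.
have c0 := short_count_gt0 R n.
have aM : 0 <= a <= M by rewrite /a /M; apply/andP; split; nra.
have M0 : 0 <= M by exact: sqr_ge0.
have M2 : 0 < M ^+ 2 by rewrite !exprn_gt0 // (lt_le_trans ltr01 m1).
pose r s : R := (sumn s)%:R ^+ k - a ^+ k - k%:R * a ^+ k.-1 * ((sumn s)%:R - a).
have rb s : s \in short_strict n ->
    M ^+ 2 * `|r s| <= k%:R ^+ 2 * M ^+ k * ((sumn s)%:R - a) ^+ 2.
  move=> sn; apply: Taylor_expn_bound => //.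
  by rewrite ler0n /M /m -natrX ler_nat sumn_short_strict_le.
have -> : (1 / 10) ^+ k * n%:R ^+ (2 * k) = a ^+ k.
  by rewrite exprM -exprMn /a mulrC mul1r.
have -> : short_sum n (fun s => (sumn s)%:R ^+ k) - a ^+ k * short_count n =
    short_sum n r + k%:R * a ^+ k.-1 * short_sum n (fun s => (sumn s)%:R - a).
  rewrite -short_sumZ -mulNr -short_sum_shift -short_sumD.
  by apply: eq_short_sum => s _; rewrite /r; ring.
rewrite -(ler_pM2l M2).
(* This turns the constants 10 and 70 into [20 = 10 * 2] and [560 = 70 * 2^3]. *)
have n1 : n.+1%:R <= 2 * m by rewrite -(natr1 n) -/m; lra.
have e1 := le_trans (sumn_dev_sum R n)
  (ler_wpM2r (ltW c0) (ler_wpM2l (ler0n R 10) n1)).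
have e2 : short_sum n (fun s => ((sumn s)%:R - a) ^+ 2) <=
    70 * (2 * m) ^+ 3 * short_count n.
  apply: le_trans (sumn_dev_sqr_sum R n) _; apply: ler_wpM2r (ltW c0) _ _ _.
  by apply: ler_wpM2l => //; apply: lerXn2r => //; rewrite nnegrE ?ler0n // /m; lra.
have rS : M ^+ 2 * `|short_sum n r| <= k%:R ^+ 2 * M ^+ k * (70 * (2 * m) ^+ 3 * short_count n).
  apply: (@le_trans _ _ (short_sum n (fun s => M ^+ 2 * `|r s|))).
    by rewrite short_sumZ; apply: ler_wpM2l (ltW M2) _ _ _; exact: ler_norm_sum.
  apply: le_trans (le_short_sum rb) _.
  by rewrite short_sumZ ler_wpM2l // mulr_ge0 ?sqr_ge0 ?exprn_ge0.
have ak : a ^+ k.-1 <= M ^+ k.-1.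
  by case/andP: aM => a0 aM; rewrite lerXn2r.
apply: le_trans (ler_wpM2l (ltW M2) (ler_normD _ _)) _; rewrite mulrDr.
apply: (@le_trans _ _ (k%:R ^+ 2 * M ^+ k * (70 * (2 * m) ^+ 3 * short_count n) +
   M ^+ 2 * (k%:R * M ^+ k.-1 * (10 * (2 * m) * short_count n)))).
  apply: lerD => //; apply: ler_wpM2l; first exact: ltW.
  rewrite normrM ger0_norm; last by rewrite mulr_ge0 // exprn_ge0 //; case/andP: aM.
  apply: ler_pM => //; first by rewrite mulr_ge0 // exprn_ge0 //; case/andP: aM.
  by rewrite ler_wpM2l.
case: k k0 {rb rS ak r} => // k _.
have -> : (2 * k.+1 - 1 = (2 * k).+1)%N by lia.
rewrite -[k.+1.-1]/k -/m (exprS m (2 * k)) (exprS M k) exprM -/M /M.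
by rewrite le_eqVlt; apply/orP; left; apply/eqP; ring.
Qed.

Theorem theorem1p9 (R : realType) (k : nat) (hk : (0 < k)%N) :
  (fun n : nat =>
     uniform_expectation (distinct_cores n n.+1)
       (fun la => (psize la)%:R ^+ k : R))
  = (fun n : nat => (1 / 10%:R) ^+ k * n%:R ^+ (2 * k))
    +O_\oo (fun n : nat => n%:R ^+ (2 * k - 1) : R).
Proof.
apply/eqaddOP; apply/bigO_exP; exists (20 * k%:R + 560 * k%:R ^+ 2) => /=.
  by rewrite ltr_wpDr ?mulr_ge0 ?sqr_ge0 // mulr_gt0 // ltr0n.
(* The bound holds from [n = 1] on, where [n + 1 <= 2 * n]. *)
exists 1%N => // n n0; rewrite -[(_ - _) n]/(_ n - _ n) /=.
have permD := perm_distinct_cores n.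
have c0 := short_count_gt0 R n.
have -> : uniform_expectation (distinct_cores n n.+1) (fun la => (psize la)%:R ^+ k : R) =
    short_sum n (fun s => (sumn s)%:R ^+ k) / short_count n.
  rewrite /uniform_expectation /short_sum /short_count -(perm_big _ permD) big_map.
  by rewrite -(perm_size permD) size_map.
rewrite (@ger0_norm _ (n%:R ^+ _)) ?exprn_ge0 //.
rewrite -(ler_pM2r c0) -[X in _ * X <= _](gtr0_norm c0) -normrM.
apply: le_trans (short_sum_expn_bound R hk n0).
by rewrite mulrBl divfK // gt_eqF.
Qed.
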